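(* Let $\mathcal{A}=E\cup B\subset\mathbb{Z}^d$ with $E=\{\mathbf{a}_1,\ldots,\mathbf{a}_r\}$, $B=\{\mathbf{b}_1,\ldots,\mathbf{b}_s\}$, be such that no nontrivial $\mathbb{N}$-linear combination of the elements of $\mathcal{A}$ is zero and $\mathrm{pos}(\mathcal{A})=\mathrm{pos}(E)$, and let $S$ be the semigroup generated by $\mathcal{A}$. Let $t$ be the length of an $\mathcal{A}$-graded free resolution $0\to\Bbbk[\mathbf{Y}]^{\beta_t}\to\cdots\to\Bbbk[\mathbf{Y}]^{\beta_0}\to\Bbbk[S]\to 0$ of $\Bbbk[S]$ as a $\Bbbk[\mathbf{Y}]$-module. Then for every $\mathbf{a}\in S$ and every $i\in\{0,\ldots,t\}$, $$\widetilde{H}_i(\Gamma_\mathbf{a})\cong\widetilde{H}_i(T_\mathbf{a}),$$ where $T_\mathbf{a}$ is the abstract simplicial complex $T_\mathbf{a}=\{F\subseteq E\mid \mathbf{a}-\sum_{\mathbf{e}\in F}\mathbf{e}\in S\}$, $\Gamma_\mathbf{a}$ is the abstract simplicial complex $\Gamma_\mathbf{a}=\{F\subseteq C_\mathbf{a}\mid \gcd(F)\neq1\}$ on the set of monomials $C_\mathbf{a}=\{\mathbf{Y}^{\mathbf{v}}\in\Bbbk[\mathbf{Y}]\mid \deg_\mathcal{A}(\mathbf{v},\mathbf{u})=\mathbf{a}\text{ for some }\mathbf{u}\in\mathcal{Q}\}$, and $\widetilde{H}_i(-)$ denotes the $i$-th reduced homology $\Bbbk$-vector space.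
   Context: $\mathbb{N}$ denotes the nonnegative integers and $\Bbbk$ is a field. $\mathcal{A}=\{\mathbf{a}_1,\ldots,\mathbf{a}_n\}\subset\mathbb{Z}^d$ is a finite set such that $\sum u_i\mathbf{a}_i=0$ with $u_i\in\mathbb{N}$ implies all $u_i=0$. $S=\mathbb{N}\mathbf{a}_1+\cdots+\mathbb{N}\mathbf{a}_n$. The polyhedral cone is $\mathrm{pos}(\mathcal{A})=\{\sum\lambda_i\mathbf{a}_i\mid\lambda_i\in\mathbb{Q}_{\ge0}\}$. The elements are labelled so that $\mathrm{pos}(\mathcal{A})=\mathrm{pos}(E)$ with $E=\{\mathbf{a}_1,\ldots,\mathbf{a}_r\}$, and $\mathbf{b}_j=\mathbf{a}_{r+j}$, $j=1,\ldots,s=n-r$, $B=\{\mathbf{b}_1,\ldots,\mathbf{b}_s\}$. $\Bbbk[\mathbf{Y}]=\Bbbk[Y_1,\ldots,Y_r]$ and $\Bbbk[\mathbf{Y},\mathbf{Z}]=\Bbbk[Y_1,\ldots,Y_r,Z_1,\ldots,Z_s]$, graded by $S$ via $\deg Y_i=\mathbf{a}_i$, $\deg Z_j=\mathbf{b}_j$. For $(\mathbf{v},\mathbf{u})\in\mathbb{N}^r\times\mathbb{N}^s$, $\deg_\mathcal{A}(\mathbf{v},\mathbf{u})=\sum_i v_i\mathbf{a}_i+\sum_j u_j\mathbf{b}_j\in S$. $\Bbbk[S]=\bigoplus_{\mathbf{a}\in S}\Bbbk\chi^{\mathbf{a}}$ is the semigroup algebra, a $\Bbbk[\mathbf{Y}]$-module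 via $Y_i\mapsto\chi^{\mathbf{a}_i}$, and $I_\mathcal{A}$ is the kernel of the $\Bbbk$-algebra map $\Bbbk[\mathbf{Y},\mathbf{Z}]\to\Bbbk[S]$, $\mathbf{Y}^{\mathbf{v}}\mathbf{Z}^{\mathbf{u}}\mapsto\chi^{\deg_\mathcal{A}(\mathbf{v},\mathbf{u})}$. $\mathcal{A}$-graded reverse lexicographical order $\prec$ with $Y_i\prec Z_j$: fix a total order on the variables in which every $Y_i$ is smaller than every $Z_j$. Then $\mathbf{Y}^{\mathbf{v}'}\mathbf{Z}^{\mathbf{u}'}\prec\mathbf{Y}^{\mathbf{v}}\mathbf{Z}^{\mathbf{u}}$ iff either the leftmost nonzero entry of $\deg_\mathcal{A}(\mathbf{v},\mathbf{u})-\deg_\mathcal{A}(\mathbf{v}',\mathbf{u}')\in\mathbb{Z}^d$ is positive, or the two degrees are equal and the smallest variable whose exponents in the two monomials differ has larger exponent in $\mathbf{Y}^{\mathbf{v}'}\mathbf{Z}^{\mathbf{u}'}$. $\mathrm{in}_\prec(I_\mathcal{A})$ is the ideal generated by the $\prec$-leading (largest) monomials of the nonzero elements of $I_\mathcal{A}$, and $\mathcal{Q}=\{\mathbf{u}\in\mathbb{N}^s\mid\mathbf{Z}^{\mathbf{u}}\notin\mathrm{in}_\prec(I_\mathcal{A})\}$. Simplicial complexes contain the empty face; in particular $\emptyset\in\Gamma_\mathbf{a}$. *)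

(* Defs.v *)
From HB Require Import structures.
From mathcomp Require Import all_boot all_order all_algebra.
From mathcomp Require Import generic_quotient ring_quotient finmap boolp.
(* monalg also has a notation for {mpoly _[_]}, for another type: only the   *)
(* one of mpoly is wanted here.                                              *)
From mathcomp.multinomials Require Import -(notations) monalg.
From mathcomp.multinomials Require Import mpoly.

Set Implicit Arguments.
Unset Strict Implicit.
Unset Printing Implicit Defensive.

Import Order.TTheory GRing.Theory Num.Theory.

Notation "{ 'malg' R [ K ] }" := (@monalg.malg K R)
  (at level 0, R, K at level 2, format "{ 'malg'  R [ K ] }") : type_scope.
Notation malgU x := (@monalg.mkmalgU _ _ x 1).

Local Open Scope fset_scope.
Local Open Scope ring_scope.
Local Open Scope quotient_scope.

(* ring_quotient only gives the additive group {quot W}; [lquot] adds the    *)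
(* scaling to the quotient of a module by a submodule.                       *)

Section LmodQuotient.
Variables (k : nzRingType) (V : lmodType k) (W : {pred V}).

Definition submod_pred of submod_closed W : V -> bool := W.

Variable subW : submod_closed W.

Let submod_pred_zmod : zmod_closed (submod_pred subW).
Proof. exact: GRing.submod_closedB subW. Qed.

HB.instance Definition _ :=
  GRing.isZmodClosed.Build V (submod_pred subW) submod_pred_zmod.

Definition lquot := Quotient.quot (GRing.ZmodClosed.clone V (submod_pred subW) _).

HB.instance Definition _ := GRing.Zmodule.on lquot.

Definition lquot_pi (x : V) : lquot := \pi_lquot x.

Lemma lquot_piE x y : (lquot_pi x = lquot_pi y) <-> (x - y \in W).
Proof.
rewrite -[x - y \in W]/(x - y \in submod_pred subW) Quotient.idealrBE.
by split=> [/eqP //|/eqP].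
Qed.

Lemma lquot_reprK (x : lquot) : lquot_pi (repr x) = x.
Proof. exact: reprK. Qed.

Lemma lquot_piD x y : lquot_pi (x + y) = lquot_pi x + lquot_pi y.
Proof. by rewrite /lquot_pi !piE. Qed.

Definition lquot_scale (c : k) (x : lquot) : lquot := lquot_pi (c *: repr x).

Lemma lquot_scale_pi c x : lquot_scale c (lquot_pi x) = lquot_pi (c *: x).
Proof.
apply/lquot_piE; rewrite -scalerBr.
have /lquot_piE Wx : lquot_pi (repr (lquot_pi x)) = lquot_pi x.
  exact: lquot_reprK.
have [W0 WZ] := subW.
by rewrite -[_ *: _]addr0; apply: WZ.
Qed.

Lemma lquot_scaleA a b v :
  lquot_scale a (lquot_scale b v) = lquot_scale (a * b) v.
Proof. by rewrite -[v]lquot_reprK !lquot_scale_pi scalerA. Qed.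

Lemma lquot_scale1 : left_id 1 lquot_scale.
Proof. by move=> v; rewrite -[v]lquot_reprK lquot_scale_pi scale1r. Qed.

Lemma lquot_scaleDr : right_distributive lquot_scale +%R.
Proof.
move=> a u v; rewrite -[u]lquot_reprK -[v]lquot_reprK -lquot_piD.
by rewrite !lquot_scale_pi -lquot_piD scalerDr.
Qed.

Lemma lquot_scaleDl v : {morph lquot_scale^~ v : a b / a + b}.
Proof.
move=> a b /=; rewrite -[v]lquot_reprK.
by rewrite !lquot_scale_pi -lquot_piD scalerDl.
Qed.

HB.instance Definition _ := GRing.Zmodule_isLmodule.Build k lquot
  lquot_scaleA lquot_scale1 lquot_scaleDr lquot_scaleDl.

Lemma lquot_pi_linear : linear lquot_pi.
Proof.
by move=> c x y; rewrite lquot_piD -lquot_scale_pi.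
Qed.

HB.instance Definition _ := GRing.isLinear.Build k V lquot *:%R lquot_pi
  lquot_pi_linear.

End LmodQuotient.

Record simplicial_complex (V : choiceType) := SimplicialComplex {
  face :> {fset V} -> Prop;
  face_fset0 : face fset0;
  face_sub : forall F G, G `<=` F -> face F -> face G
}.

Section ReducedHomology.
Variables (k : fieldType) (disp : Order.disp_t) (V : orderType disp).
Variable K : simplicial_complex V.

Local Notation chain := {malg k[{fset V}]}.

(* Chains are graded by the cardinality of the faces, so that the empty face *)
(* spans the chains of cardinality 0 and the homology below is reduced.      *)
Definition is_chain (n : nat) (c : chain) : Prop :=
  forall F, F \in monalg.msupp c -> #|` F| = n /\ K F.

(* [x0 < ... < xn] |-> \sum_j (-1)^j [x0, .., x(j-1), x(j+1), .., xn]        *)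
Definition boundary_face (F : {fset V}) : chain :=
  \sum_(x <- F) (-1) ^+ #|` [fset y in F | (y < x)%O]| *: malgU (F `\ x).

Definition boundary (c : chain) : chain :=
  \sum_(F <- monalg.msupp c) monalg.mcoeff F c *: boundary_face F.

Definition is_cycle (i : nat) : {pred chain} :=
  fun c => `[< is_chain i.+1 c /\ boundary c = 0 >].

Lemma boundaryEw (c : chain) (D : {fset {fset V}}) :
    monalg.msupp c `<=` D ->
  boundary c = \sum_(F <- D) monalg.mcoeff F c *: boundary_face F.
Proof.
move=> sD; rewrite /boundary (big_fset_incl _ sD) // => F _ nF.
by rewrite (monalg.mcoeff_outdom nF) scale0r.
Qed.

Lemma boundary_linear : linear boundary.
Proof.
move=> a c e; set D := monalg.msupp c `|` monalg.msupp e.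
have sc : monalg.msupp c `<=` D by apply: fsubsetUl.
have se : monalg.msupp e `<=` D by apply: fsubsetUr.
have sac : monalg.msupp (a *: c + e) `<=` D.
  apply: fsubset_trans (monalg.msuppD_le _ _) _; apply: fsetSU.
  exact: monalg.msuppZ_le.
rewrite (boundaryEw sc) (boundaryEw se) (boundaryEw sac) scaler_sumr -big_split.
apply: eq_bigr => F _ /=.
by rewrite monalg.mcoeffD monalg.mcoeffZ scalerDl scalerA.
Qed.

HB.instance Definition _ := GRing.isLinear.Build k chain chain *:%R boundary
  boundary_linear.

Lemma is_chain0 n : is_chain n 0.
Proof. by move=> F; rewrite monalg.msupp0 inE. Qed.

Lemma is_chainP n a c e :
  is_chain n c -> is_chain n e -> is_chain n (a *: c + e).
Proof.
move=> hc he F /(fsubsetP (monalg.msuppD_le _ _)); rewrite inE => /orP[|/he //].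
by move/(fsubsetP (monalg.msuppZ_le _ _))/hc.
Qed.

Lemma is_cycle_submod i : submod_closed (is_cycle i).
Proof.
split=> [|a c e /asboolP[hc bc] /asboolP[he be]]; apply/asboolP.
  by split; [exact: is_chain0 | rewrite linear0].
by split; [exact: is_chainP | rewrite boundary_linear bc be scaler0 addr0].
Qed.

HB.instance Definition _ i := GRing.isSubmodClosed.Build k chain (is_cycle i)
  (is_cycle_submod i).

Definition cycles (i : nat) := {c : chain | is_cycle i c}.

HB.instance Definition _ i := [isSub of cycles i for sval].
HB.instance Definition _ i := [Choice of cycles i by <:].
HB.instance Definition _ i := [SubChoice_isSubLmodule of cycles i by <:].

Definition is_boundary (i : nat) : {pred cycles i} :=
  fun z => `[< exists2 c : chain, is_chain i.+2 c & val z = boundary c >].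

Lemma is_boundary_submod i : submod_closed (is_boundary (i := i)).
Proof.
split=> [|a z w /asboolP[c hc zE] /asboolP[e he wE]]; apply/asboolP.
  by exists 0; [exact: is_chain0 | rewrite linear0 raddf0].
exists (a *: c + e); first exact: is_chainP.
by rewrite boundary_linear -zE -wE; exact: linearP.
Qed.

Definition reduced_homology (i : nat) : lmodType k :=
  lquot (@is_boundary_submod i).

End ReducedHomology.

Section Cone.
Variables (d m : nat) (a : 'I_m -> 'rV[int]_d).

Definition pos (x : 'rV[rat]_d) : Prop :=
  exists2 l : 'I_m -> rat, (forall i, 0 <= l i) &
    x = \sum_i l i *: map_mx intr (a i).

End Cone.

Section Semigroup.
Variables (d n : nat) (a : 'I_n -> 'rV[int]_d).

Definition degA (m : 'X_{1..n}) : 'rV[int]_d := \sum_i a i *+ m i.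

Definition in_semigroup (w : 'rV[int]_d) : Prop := exists m, w = degA m.

Definition pointed : Prop := forall m : 'X_{1..n}, degA m = 0 -> m = 0%MM.

Lemma degA0 : degA 0%MM = 0.
Proof. by rewrite /degA big1 // => i _; rewrite mnm0E mulr0n. Qed.

Lemma degAD m m' : degA (m + m')%MM = degA m + degA m'.
Proof.
by rewrite /degA -big_split; apply: eq_bigr => i _; rewrite mnmDE mulrnDr.
Qed.

Lemma degA1 i : degA U_(i)%MM = a i.
Proof.
rewrite /degA (bigD1 i) //= mnm1E eqxx mulr1n big1 ?addr0 // => j ji.
by rewrite mnm1E eq_sym (negbTE ji) mulr0n.
Qed.

(* The generators are pointed precisely when the only unit of the semigroup  *)
(* is 0, which is what monalg requires of the exponents of a monoid algebra. *)
Definition semigroup of pointed := {w : 'rV[int]_d | `[< in_semigroup w >]}.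

Hypothesis pa : pointed.

HB.instance Definition _ := [isSub of semigroup pa for sval].
HB.instance Definition _ := [Choice of semigroup pa by <:].

Lemma semigroup_deg (m : 'X_{1..n}) : `[< in_semigroup (degA m) >].
Proof. by apply/asboolP; exists m. Qed.

Definition sdeg (m : 'X_{1..n}) : semigroup pa := Sub (degA m) (semigroup_deg m).

Lemma semigroupP (w : semigroup pa) : in_semigroup (val w).
Proof. exact/asboolP/(valP w). Qed.

Lemma semigroup_add_subproof (u v : semigroup pa) :
  `[< in_semigroup (val u + val v) >].
Proof.
have [m ->] := semigroupP u; have [m' ->] := semigroupP v.
by rewrite -degAD semigroup_deg.
Qed.

Definition semigroup_add (u v : semigroup pa) : semigroup pa :=
  Sub (val u + val v) (semigroup_add_subproof u v).

Lemma semigroup_addA : associative semigroup_add.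
Proof. by move=> u v w; apply: val_inj; rewrite /= addrA. Qed.

Lemma semigroup_addC : commutative semigroup_add.
Proof. by move=> u v; apply: val_inj; rewrite /= addrC. Qed.

Lemma semigroup_add0 : left_id (sdeg 0%MM) semigroup_add.
Proof. by move=> u; apply: val_inj; rewrite /= degA0 add0r. Qed.

Lemma semigroup_addr0 : right_id (sdeg 0%MM) semigroup_add.
Proof. by move=> u; rewrite semigroup_addC semigroup_add0. Qed.

Lemma semigroup_unit (u v : semigroup pa) :
  semigroup_add u v = sdeg 0%MM -> u = sdeg 0%MM /\ v = sdeg 0%MM.
Proof.
move=> /(congr1 val) /=; have [m uE] := semigroupP u.
have [m' vE] := semigroupP v; rewrite uE vE degA0 -degAD => /pa mm'0.
have m0 : m = 0%MM /\ m' = 0%MM.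
  split; apply/mnmP => i; move/mnmP/(_ i): mm'0; rewrite mnmDE mnm0E;
  by move/eqP; rewrite addn_eq0 => /andP[/eqP ? /eqP ?].
by case: m0 uE vE => -> -> uE vE; split; apply: val_inj.
Qed.

HB.instance Definition _ := Choice_isMonomialDef.Build (semigroup pa)
  semigroup_addA semigroup_add0 semigroup_addr0 semigroup_unit.
HB.instance Definition _ := MonomialDef_isConomialDef.Build (semigroup pa)
  semigroup_addC.

End Semigroup.

Section Ideals.
Variables (k : fieldType) (n : nat).

Definition ideal_span (G : {mpoly k[n]} -> Prop) (p : {mpoly k[n]}) : Prop :=
  exists N (c g : 'I_N -> {mpoly k[n]}),
    (forall i, G (g i)) /\ p = \sum_i c i * g i.

Variable prec : 'X_{1..n} -> 'X_{1..n} -> Prop.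

Definition leading_mnm (p : {mpoly k[n]}) (m : 'X_{1..n}) : Prop :=
  m \in msupp p /\ forall m', m' \in msupp p -> m' != m -> prec m' m.

Definition initial_ideal (I : {mpoly k[n]} -> Prop) : {mpoly k[n]} -> Prop :=
  ideal_span (fun g => exists p m,
    [/\ p != 0, I p, leading_mnm p m & g = 'X_[m]]).

End Ideals.

Section Toric.
Variables (k : fieldType) (d r s : nat) (a : 'I_(r + s) -> 'rV[int]_d).

Definition mnm_join (v : 'X_{1..r}) (u : 'X_{1..s}) : 'X_{1..r + s} :=
  [multinom match split i with inl j => v j | inr j => u j end | i < r + s].

(* [le x y] compares variables, so that a smaller variable weighs more in    *)
(* the tie-breaking rule.                                                    *)
Definition revlex (le : rel 'I_(r + s)) (m' m : 'X_{1..r + s}) : Prop :=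
  (exists c : 'I_d, 0 < (degA a m - degA a m') 0 c /\
     forall c' : 'I_d, (c' < c)%N -> (degA a m - degA a m') 0 c' = 0)
  \/ (degA a m = degA a m' /\
      exists x, (m x < m' x)%N /\ forall y, le y x -> y != x -> m y = m' y).

Definition variable_order (le : rel 'I_(r + s)) : Prop :=
  [/\ antisymmetric le, transitive le, total le &
      forall i j, le (lshift s i) (rshift r j)].

Hypothesis pa : pointed a.

Local Notation semigroup_algebra := {malg k[semigroup pa]}.

Definition chi (w : semigroup pa) : semigroup_algebra := malgU w.

Definition toric_map (p : {mpoly k[r + s]}) : semigroup_algebra :=
  mmap (GRing.in_alg semigroup_algebra) (fun i => chi (sdeg pa U_(i)%MM)) p.

Definition toric_ideal (p : {mpoly k[r + s]}) : Prop := toric_map p = 0.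

Definition Qset (le : rel 'I_(r + s)) (u : 'X_{1..s}) : Prop :=
  ~ initial_ideal (revlex le) toric_ideal 'X_[mnm_join 0%MM u].

(* p : k[Y] acts on f : k[S] by ymap p * f.                                  *)
Definition ymap (p : {mpoly k[r]}) : semigroup_algebra :=
  mmap (GRing.in_alg semigroup_algebra)
       (fun i => chi (sdeg pa U_(lshift s i)%MM)) p.

(* Graded free resolutions 0 -> F_t -> ... -> F_0 -> k[S] -> 0 over k[Y],    *)
(* where F_j is the module of row vectors of length [rank j], in which the   *)
(* x-th vector of the standard basis has degree [gdeg j x]; F_(j.+1) -> F_j  *)
(* is q |-> q *m res_diff j. The modules F_j are 0 for j > t, so that the    *)
(* exactness at F_t says that its differential is injective.                 *)
Record graded_free_resolution (t : nat) := GradedFreeResolution {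
  rank : nat -> nat;
  gdeg : forall j, 'I_(rank j) -> semigroup pa;
  res_diff : forall j, 'M[{mpoly k[r]}]_(rank j.+1, rank j);
  res_aug : 'I_(rank 0) -> semigroup_algebra;
  rank_gt : forall j, (t < j)%N -> rank j = 0%N;
  res_diff_homog : forall j x y m, m \in msupp (res_diff j x y) ->
    degA a (mnm_join m 0%MM) + val (gdeg y) = val (gdeg x);
  res_aug_homog : forall x w, w \in monalg.msupp (res_aug x) -> w = gdeg x;
  res_aug_surj : forall f, exists p : 'rV[{mpoly k[r]}]_(rank 0),
    \sum_x ymap (p 0 x) * res_aug x = f;
  res_exact0 : forall p : 'rV[{mpoly k[r]}]_(rank 0),
    \sum_x ymap (p 0 x) * res_aug x = 0 <-> exists q, p = q *m res_diff 0;
  res_exactS : forall j (p : 'rV[{mpoly k[r]}]_(rank j.+1)),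
    p *m res_diff j = 0 <-> exists q, p = q *m res_diff j.+1
}.

End Toric.

(* For nonempty [F]; the maxima are there because minn has no unit.          *)
Definition mnm_gcd (r : nat) (F : {fset 'X_{1..r}}) : 'X_{1..r} :=
  [multinom (\big[minn / (\max_(v <- F) (v : 'X_{1..r}) i)]_(v <- F)
     (v : 'X_{1..r}) i)%N | i < r].

Lemma bigmin_le_seq (T : eqType) (l : seq T) (c : nat) (f : T -> nat) x :
  x \in l -> (\big[minn/c]_(y <- l) f y <= f x)%N.
Proof.
elim: l => // y l IH; rewrite big_cons inE => /orP[/eqP ->|/IH {}IH].
  exact: geq_minl.
exact: leq_trans (geq_minr _ _) IH.
Qed.

Lemma mnm_gcdP (r : nat) (F : {fset 'X_{1..r}}) (g : 'X_{1..r}) :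
  F != fset0 ->
  (g <= mnm_gcd F)%MM <-> (forall v, v \in F -> (g <= v)%MM).
Proof.
move=> /fset0Pn[v0 Fv0]; split=> [/mnm_lepP gF v Fv | gF].
  apply/mnm_lepP => i; apply: leq_trans (gF i) _; rewrite mnmE.
  exact: bigmin_le_seq.
apply/mnm_lepP => i; rewrite mnmE big_seq.
elim/big_ind: _ => [|x y gx gy|v Fv]; last by move/mnm_lepP: (gF v Fv).
  apply: (@leq_trans (v0 i)); first by move/mnm_lepP: (gF v0 Fv0).
  exact: (@leq_bigmax_seq _ _ xpredT (fun v : 'X_{1..r} => v i) v0 Fv0 isT).
by rewrite leq_min gx.
Qed.

Section Complexes.
Variables (k : fieldType) (d r s : nat) (a : 'I_(r + s) -> 'rV[int]_d).
Variables (pa : pointed a) (le : rel 'I_(r + s)) (w : semigroup pa).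

Definition Cset (v : 'X_{1..r}) : Prop :=
  exists2 u : 'X_{1..s}, Qset k pa le u & degA a (mnm_join v u) = val w.

(* gcd of the empty set is 0 in a polynomial ring, so fset0 is a face.       *)
Definition Gamma_face (F : {fset 'X_{1..r}}) : Prop :=
  (forall v, v \in F -> Cset v) /\ (F = fset0 \/ mnm_gcd F <> 0%MM).

Lemma Gamma_face0 : Gamma_face fset0.
Proof. by split; [move=> v; rewrite inE | left]. Qed.

Lemma Gamma_face_sub F G : G `<=` F -> Gamma_face F -> Gamma_face G.
Proof.
move=> /fsubsetP GF [CF gF]; split=> [v /GF /CF //|].
have [-> | G0] := eqVneq G fset0; [by left | right].
have /fset0Pn[v0 /GF Fv0] := G0.
have F0 : F != fset0 by apply/fset0Pn; exists v0.
case: gF => [F00 | gF]; first by rewrite F00 eqxx in F0.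
move=> gG; apply: gF; apply/mnmP => i; apply/eqP; rewrite mnm0E -leqn0.
have : (mnm_gcd F <= mnm_gcd G)%MM.
  apply/(mnm_gcdP _ G0) => v /GF.
  exact: ((mnm_gcdP (mnm_gcd F) F0).1 (lepm_refl _) v).
by rewrite gG => /mnm_lepP/(_ i); rewrite mnm0E.
Qed.

Definition Gamma : simplicial_complex 'X_{1..r} :=
  SimplicialComplex Gamma_face0 Gamma_face_sub.

(* The vertex i stands for the i-th element of E; [a] is injective.          *)
Definition T_face (F : {fset 'I_r}) : Prop :=
  in_semigroup a (val w - \sum_(i <- F) a (lshift s i)).

Lemma T_face0 : T_face fset0.
Proof. by rewrite /T_face big_seq_fset0 subr0; exact: semigroupP. Qed.

Lemma T_face_sub F G : G `<=` F -> T_face F -> T_face G.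
Proof.
move=> GF [m mE]; exists (m + \big[mnm_add/0%MM]_(i <- F `\` G) U_(lshift s i))%MM.
rewrite degAD -mE (big_morph _ (@degAD _ _ a) (@degA0 _ _ a)).
under [X in _ = _ + X]eq_bigr do rewrite degA1.
rewrite (big_fsetID _ (mem G) F) /=.
have -> : [fset x in F | x \in G] = G.
  by apply/fsetP => x; rewrite !inE andb_idl // => /(fsubsetP GF).
have -> : [fset x in F | x \notin G] = F `\` G.
  by apply/fsetP => x; rewrite !inE andbC.
by rewrite opprD addrA addrNK.
Qed.

Definition T_complex : simplicial_complex 'I_r :=
  SimplicialComplex T_face0 T_face_sub.

End Complexes.

(* Main.v *)
(* The vertices of [Gamma] are monomials v of C_a, those of [T_complex] are
   indices i, and both complexes are read off the relation "Y_i divides v": a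
   set of monomials is a face of [Gamma] when one variable divides all of them,
   and a set of variables is a face of [T_complex] when all of them divide one
   monomial. For the latter, every element of S has the form deg(v, u) with u
   in Q: take the smallest monomial in the fibre, which exists by Dickson's
   lemma because pointedness makes the fibres antichains.

   The isomorphism is then Dowker duality. Pairs (F, G) of faces with F x G
   inside the relation span a double complex whose rows and columns are
   contractible, except for the augmentation row and column, which are the two
   chain complexes. If h2 contracts d2, the zigzag d1 o h2 moves bidegree
   (p + 1, q) to (p, q + 1) and induces an isomorphism between the elements
   killed by d1 and d2, modulo the image of d1 d2, in these two bidegrees. *)

Require Import Defs.
From mathcomp Require Import all_boot all_order all_algebra.
From mathcomp Require Import finmap boolp.
From mathcomp.multinomials Require Import -(notations) monalg.
From mathcomp.multinomials Require Import mpoly.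
From HB Require Import structures.

Set Implicit Arguments.
Unset Strict Implicit.
Unset Printing Implicit Defensive.

Import Order.TTheory GRing.Theory Num.Theory.
Local Open Scope fset_scope.
Local Open Scope ring_scope.

(** * Chains and cones *)

(* Locked: unification would otherwise unfold finitely supported functions. *)
HB.lock Definition gen (k : fieldType) (T : choiceType) (x : T)
  : {malg k[T]} := malgU x.
HB.lock Definition lin_ext (k : fieldType) (T : choiceType) (V : lmodType k)
    (f : T -> V) (c : {malg k[T]}) : V :=
  \sum_(x <- monalg.msupp c) monalg.mcoeff x c *: f x.

Section LinearExtension.
Variables (k : fieldType) (T : choiceType).
Implicit Types (x : T) (c : {malg k[T]}) (P : T -> Prop).

Lemma msupp_gen x : monalg.msupp (gen k x) = [fset x].
Proof. by rewrite gen.unlock monalg.msuppU oner_eq0. Qed.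

Section Def.
Variables (V : lmodType k) (f : T -> V).

Lemma lin_extEw c (D : {fset T}) : monalg.msupp c `<=` D ->
  lin_ext f c = \sum_(x <- D) monalg.mcoeff x c *: f x.
Proof.
move=> sD; rewrite lin_ext.unlock (big_fset_incl _ sD) // => x _ nx.
by rewrite (monalg.mcoeff_outdom nx) scale0r.
Qed.

Lemma lin_ext_linear : linear (lin_ext f).
Proof.
move=> b c e; set D := monalg.msupp c `|` monalg.msupp e.
have sc : monalg.msupp c `<=` D by apply: fsubsetUl.
have se : monalg.msupp e `<=` D by apply: fsubsetUr.
have sbc : monalg.msupp (b *: c + e) `<=` D.
  apply: fsubset_trans (monalg.msuppD_le _ _) _; apply: fsetSU.
  exact: monalg.msuppZ_le.
rewrite (lin_extEw sc) (lin_extEw se) (lin_extEw sbc) scaler_sumr -big_split.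
apply: eq_bigr => x _ /=.
by rewrite monalg.mcoeffD monalg.mcoeffZ scalerDl scalerA.
Qed.

HB.instance Definition _ :=
  GRing.isLinear.Build k {malg k[T]} V *:%R (lin_ext f) lin_ext_linear.

Lemma lin_ext_gen x : lin_ext f (gen k x) = f x.
Proof.
by rewrite lin_ext.unlock msupp_gen big_seq_fset1 gen.unlock /= monalg.mcoeffUU
  scale1r.
Qed.

End Def.

Lemma malg_sumE c :
  c = \sum_(x <- monalg.msupp c) monalg.mcoeff x c *: gen k x.
Proof.
rewrite [LHS]monalg.monalgE; apply: eq_bigr => x _; apply/monalg.malgP => y.
by rewrite gen.unlock monalg.mcoeffZ !monalg.mcoeffU mulrnAr mulr1.
Qed.

(** Agreement is asked only on the basis elements in the support of [c], so that identities valid on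
    part of the basis, as in [fst_chainK] and [dleft_hleft], reduce to it as well. *)
Lemma eq_linear_malg (V : lmodType k) (g h : {linear {malg k[T]} -> V}) c :
    (forall x, x \in monalg.msupp c -> g (gen k x) = h (gen k x)) ->
  g c = h c.
Proof.
move=> gh; rewrite [c]malg_sumE !linear_sum big_seq [RHS]big_seq.
by apply: eq_bigr => x cx; rewrite !linearZ gh.
Qed.

Definition supp_in P c : Prop := forall x, x \in monalg.msupp c -> P x.

Lemma supp_in0 P : supp_in P 0.
Proof. by move=> x; rewrite monalg.msupp0 inE. Qed.

Lemma supp_in_gen P x : P x -> supp_in P (gen k x).
Proof. by move=> Px y; rewrite msupp_gen !inE => /eqP ->. Qed.

Lemma supp_inZ P b c : supp_in P c -> supp_in P (b *: c).
Proof. by move=> Pc x /(fsubsetP (monalg.msuppZ_le _ _)) /Pc. Qed.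

Lemma supp_inD P c e : supp_in P c -> supp_in P e -> supp_in P (c + e).
Proof.
move=> Pc Pe x /(fsubsetP (monalg.msuppD_le _ _)).
by rewrite inE => /orP[/Pc|/Pe].
Qed.

Lemma supp_in_sum P (I : eqType) (l : seq I) (F : I -> {malg k[T]}) :
  (forall j, j \in l -> supp_in P (F j)) -> supp_in P (\sum_(j <- l) F j).
Proof.
move=> PF; rewrite big_seq; elim/big_ind: _ => // [|c e].
  exact: supp_in0.
exact: supp_inD.
Qed.

End LinearExtension.

Lemma supp_in_lin_ext (k : fieldType) (T U : choiceType)
    (f : T -> {malg k[U]}) (P : U -> Prop) (c : {malg k[T]}) :
    (forall x, x \in monalg.msupp c -> supp_in P (f x)) ->
  supp_in P (lin_ext f c).
Proof. by move=> Pf; rewrite lin_ext.unlock; apply: supp_in_sum => x /Pf Pfx;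
  apply: supp_inZ. Qed.

Section Cone.
Variables (k : fieldType) (disp : Order.disp_t) (V : orderType disp).
Implicit Types (F : {fset V}) (x y : V).

Local Notation chain := {malg k[{fset V}]}.
Local Notation bd := (@boundary k disp V).

(** Counting the elements below [x] makes sense also for [x] outside [F], so one sign serves both to
    delete a vertex and to insert it. *)
Definition face_sign x F : k := (-1) ^+ #|` [fset z in F | (z < x)%O]|.

Lemma face_sign_mul_self x F : face_sign x F * face_sign x F = 1.
Proof. by rewrite -expr2 sqrr_sign. Qed.

Lemma face_signU1 x y F : y \notin F ->
  face_sign x (y |` F) = (if (y < x)%O then -1 else 1) * face_sign x F.
Proof.
move=> Fy; rewrite /face_sign; case: ifP => yx.
  have -> : [fset z in y |` F | (z < x)%O] = y |` [fset z in F | (z < x)%O].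
    apply/fsetP => z; rewrite !inE andb_orl.
    by case: eqVneq => // ->; rewrite yx.
  by rewrite cardfsU1 !inE /= (negbTE Fy) add1n exprS.
rewrite mul1r; congr (_ ^+ #|` _|); apply/fsetP => z; rewrite !inE andb_orl.
by case: eqVneq => // ->; rewrite yx (negbTE Fy).
Qed.

Lemma face_signU1_self x F : x \notin F -> face_sign x (x |` F) = face_sign x F.
Proof. by move=> Fx; rewrite face_signU1 // ltxx mul1r. Qed.

Lemma boundary_faceE F :
  boundary_face k F = \sum_(x <- F) face_sign x F *: gen k (F `\ x).
Proof. by rewrite gen.unlock. Qed.

Lemma boundaryE (c : chain) : boundary c = lin_ext (@boundary_face k disp V) c.
Proof. by rewrite lin_ext.unlock. Qed.

Lemma boundary_gen F : boundary (gen k F) = boundary_face k F.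
Proof. by rewrite boundaryE lin_ext_gen. Qed.

(** The join with [x]; a face that already contains [x] would become degenerate and is sent to 0. *)
Definition cone_face x F : {malg k[{fset V}]} :=
  if x \in F then 0 else face_sign x F *: gen k (x |` F).

(** On a face containing [x] the cone vanishes, and only the facet opposite [x] survives in the cone
    of the boundary. On any other face that facet of the cone returns the face, and the remaining
    terms cancel in pairs. *)
Lemma boundary_cone x (c : {malg k[{fset V}]}) :
  boundary (lin_ext (cone_face x) c) + lin_ext (cone_face x) (boundary c) = c.
Proof.
pose cone : chain -> chain := lin_ext (cone_face x).
pose g : {linear chain -> chain} := (bd \o cone) \+ (cone \o bd).
rewrite -[LHS]/(g c); apply: (@eq_linear_malg _ _ _ g idfun) => F _ /=.
rewrite /g /= lin_ext_gen.
rewrite boundary_gen {1}/cone_face; case: ifPn => Fx.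
  rewrite linear0 add0r boundary_faceE (big_fsetD1 x) //= linearD linearZ
    linear_sum.
  rewrite /= lin_ext_gen {1}/cone_face !inE eqxx /= -{1}(fsetD1K Fx).
  rewrite face_signU1_self ?inE ?eqxx // scalerA face_sign_mul_self scale1r.
  rewrite fsetD1K // big_seq big1 ?addr0 // => y; rewrite !inE => /andP[yx Fy].
  by rewrite linearZ /= lin_ext_gen /cone_face !inE eq_sym yx Fx scaler0.
rewrite linearZ /= boundary_gen !boundary_faceE linear_sum big_fsetU1 //=.
rewrite [X in X + _ + _]scalerA face_signU1_self // face_sign_mul_self scale1r.
rewrite fsetU1K // -addrA linear_sum -big_split /= big_seq big1 ?addr0 //.
move=> y Fy; rewrite [lin_ext _ _]linearZ /= lin_ext_gen /cone_face !inE
  (negbTE Fx) andbF.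
have yx : y != x by apply: contraNneq Fx => <-.
have -> : (x |` F) `\ y = x |` (F `\ y).
  apply/fsetP => z; rewrite !inE; case: (eqVneq z x) => [->|] //=.
  by rewrite eq_sym yx.
rewrite !scalerA -scalerDl; set G := F `\ y.
have Gy : y \notin G by rewrite !inE eqxx.
have Gx : x \notin G by rewrite !inE (negbTE Fx) andbF.
have -> : F = y |` G by rewrite fsetD1K.
have xyG : x \notin y |` G by rewrite !inE negb_or eq_sym yx.
rewrite !face_signU1 // ltxx !mul1r.
(* Exactly one of [x < y] and [y < x] holds, so inserting [x] and deleting [y] in the two possible
   orders gives opposite signs. *)
rewrite [X in X *: _](_ : _ = 0) ?scale0r // mulrC [face_sign y G * _]mulrC.
case: ltgtP yx => // _ _; rewrite ?mul1r ?mulN1r.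
  by rewrite mulNr mulrC addNr.
by rewrite mulrN mulrC addNr.
Qed.

(* A nonempty face is a cone over the opposite facet, so induct on its size. *)
Lemma boundaryK (c : {malg k[{fset V}]}) : boundary (boundary c) = 0.
Proof.
pose g : {linear chain -> chain} := bd \o bd.
rewrite -[LHS]/(g c) -[RHS]/((\0 : {linear chain -> chain}) c).
apply: eq_linear_malg => F _ /=; rewrite /g /=.
have [n] := ubnP #|` F|; elim: n F => // n IH F leFn.
have [->|/fset0Pn[x Fx]] := eqVneq F fset0.
  by rewrite boundary_gen boundary_faceE big_seq_fset0 linear0.
have Gx : x \notin F `\ x by rewrite !inE eqxx.
have -> : gen k F = face_sign x (F `\ x) *: lin_ext (cone_face x) (gen k (F `\
  x)).
  by rewrite lin_ext_gen /cone_face (negbTE Gx) scalerA face_sign_mul_self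
    scale1r fsetD1K.
(* With G the facet, D the boundary and C the cone: D (D (C G)) = D G - D (C (D G)) = C (D (D G)),
   which vanishes by induction. *)
rewrite !linearZ /= (canRL (addrK _) (boundary_cone x (gen k (F `\ x)))).
rewrite linearB /= (canRL (addrK _) (boundary_cone x (bd (gen k (F `\ x))))).
rewrite IH ?linear0; last by rewrite (cardfsD1 x) Fx in leFn.
by rewrite addr0 subrr scaler0.
Qed.

End Cone.

(** * Maps induced on reduced homology *)

Section HomologyIso.
Variables (k : fieldType) (d1 d2 : Order.disp_t).
Variables (V : orderType d1) (W : orderType d2).
Variables (K : simplicial_complex V) (L : simplicial_complex W) (i : nat).
Variable f : {linear {malg k[{fset V}]} -> {malg k[{fset W}]}}.
Hypothesis f_cycle : forall c, is_cycle K i c -> is_cycle L i (f c).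
Hypothesis f_boundary : forall c, is_chain K i.+2 c ->
  exists2 c', is_chain L i.+2 c' & f (boundary c) = boundary c'.

Definition cycle_map (z : cycles k K i) : cycles k L i :=
  exist _ (f (val z)) (f_cycle (valP z)).

Definition homology_map (x : reduced_homology k K i) : reduced_homology k L i :=
  lquot_pi (@is_boundary_submod k _ _ L i) (cycle_map (repr x)).

(** Two representatives of a class differ by a boundary, which [f] sends to a boundary; hence the
    choice made by [repr] is harmless. *)
Lemma homology_map_pi z :
  homology_map (lquot_pi (@is_boundary_submod k _ _ K i) z) =
  lquot_pi (@is_boundary_submod k _ _ L i) (cycle_map z).
Proof.
apply/lquot_piE.
have /lquot_piE/asboolP[c Kc zE] :=
  lquot_reprK (lquot_pi (@is_boundary_submod k _ _ K i) z).
have [c' Lc' cE] := f_boundary Kc.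
by apply/asboolP; exists c' => //; rewrite -cE -zE !raddfB.
Qed.

Lemma homology_map_linear : linear homology_map.
Proof.
move=> b x y; rewrite -[x]lquot_reprK -[y]lquot_reprK -linearP !homology_map_pi.
rewrite -linearP; congr (lquot_pi _ _); apply: val_inj.
by rewrite /= !linearP.
Qed.

End HomologyIso.

(** The maps are constrained on cycles and boundaries only. This suits zigzags, which depend on
    chosen contractions and are mutually inverse only up to boundaries. *)
Lemma homology_iso (k : fieldType) (d1 d2 : Order.disp_t)
    (V : orderType d1) (W : orderType d2)
    (K : simplicial_complex V) (L : simplicial_complex W) (i : nat)
    (f : {linear {malg k[{fset V}]} -> {malg k[{fset W}]}})
    (g : {linear {malg k[{fset W}]} -> {malg k[{fset V}]}}) :
    (forall c, is_cycle K i c -> is_cycle L i (f c)) ->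
    (forall c, is_cycle L i c -> is_cycle K i (g c)) ->
    (forall c, is_chain K i.+2 c ->
       exists2 c', is_chain L i.+2 c' & f (boundary c) = boundary c') ->
    (forall c, is_chain L i.+2 c ->
       exists2 c', is_chain K i.+2 c' & g (boundary c) = boundary c') ->
    (forall c, is_cycle K i c ->
       exists2 c', is_chain K i.+2 c' & g (f c) - c = boundary c') ->
    (forall c, is_cycle L i c ->
       exists2 c', is_chain L i.+2 c' & f (g c) - c = boundary c') ->
  exists h : {linear reduced_homology k K i -> reduced_homology k L i},
    bijective h.
Proof.
move=> fZ gZ fB gB gf fg.
pose hL := GRing.isLinear.Build k (reduced_homology k K i)
  (reduced_homology k L i) *:%R _ (homology_map_linear fZ fB).
pose h : {linear reduced_homology k K i -> reduced_homology k L i} :=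
  HB.pack (homology_map fZ) hL.
exists h.
exists (homology_map gZ) => x /=.
  rewrite -[x]lquot_reprK (homology_map_pi fZ fB) (homology_map_pi gZ gB).
  apply/lquot_piE/asboolP.
  have [c Kc cE] := gf _ (valP (repr x)).
  by exists c => //; rewrite -cE raddfB.
rewrite -[x]lquot_reprK (homology_map_pi gZ gB) (homology_map_pi fZ fB).
apply/lquot_piE/asboolP.
have [c Lc cE] := fg _ (valP (repr x)).
by exists c => //; rewrite -cE raddfB.
Qed.

(** * Zigzags in a double complex *)

Section Bicomplex.
Variables (k : fieldType) (M : lmodType k).
Variables (P : nat -> nat -> M -> Prop) (d1 d2 h1 h2 : {linear M -> M}).

Definition bicycle p q (c : M) : Prop := [/\ P p q c, d1 c = 0 & d2 c = 0].

Definition biboundary p q (c : M) : Prop :=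
  exists2 e, P p.+1 q.+1 e & c = d1 (d2 e).

Hypothesis PB : forall p q, submod_closed (fun c => `[< P p q c >]).
Hypothesis Pd1 : forall p q c, P p.+1 q c -> P p q (d1 c).
Hypothesis Pd2 : forall p q c, P p q.+1 c -> P p q (d2 c).
(** [h1] contracts [d1] where the second index is positive, and [h2] contracts [d2] where the first
    is. The two edges of index 0 are left out: they carry the homology to be compared. *)
Hypothesis Ph1 : forall p q c, P p q.+1 c -> P p.+1 q.+1 (h1 c).
Hypothesis Ph2 : forall p q c, P p.+1 q c -> P p.+1 q.+1 (h2 c).
Hypothesis d1d1 : forall c, d1 (d1 c) = 0.
Hypothesis d1d2 : forall c, d1 (d2 c) = d2 (d1 c).
Hypothesis d1h1 : forall p q c, P p q.+1 c -> d1 (h1 c) + h1 (d1 c) = c.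
Hypothesis d2h2 : forall p q c, P p.+1 q c -> d2 (h2 c) + h2 (d2 c) = c.

Definition zigzag : M -> M := d1 \o h2.
HB.instance Definition _ := GRing.Linear.on zigzag.

Lemma biboundaryD p q c e :
  biboundary p q c -> biboundary p q e -> biboundary p q (c + e).
Proof.
move=> [c' Pc ->] [e' Pe ->]; exists (c' + e'); last by rewrite !linearD.
have [_ PL] := PB p.+1 q.+1; move: (PL 1 c' e'); rewrite scale1r.
by move=> PL1; apply/asboolP/PL1; apply/asboolP.
Qed.

Lemma biboundaryN p q c : biboundary p q c -> biboundary p q (- c).
Proof.
move=> [c' Pc ->]; exists (- c'); last by rewrite !linearN.
have [P0 PL] := PB p.+1 q.+1; move: (PL (-1) c' 0); rewrite addr0 scaleN1r.
by move=> PL1; apply/asboolP/PL1 => //; apply/asboolP.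
Qed.

(** Since [d2 c = 0], the contraction gives [d2 (h2 c) = c]; thus [d2 (d1 (h2 c)) = d1 c = 0]. *)
Lemma bicycle_zigzag p q c : bicycle p.+1 q c -> bicycle p q.+1 (zigzag c).
Proof.
move=> [Pc d1c d2c]; split=> /=; first exact/Pd1/Ph2.
  by rewrite d1d1.
rewrite -d1d2; move: (d2h2 Pc); rewrite d2c linear0 addr0 => ->.
by rewrite d1c.
Qed.

(** Contract [d1 e]: [h2 (d2 (d1 e)) = d1 e - d2 (h2 (d1 e))]. Applying [d1] kills the first term,
    so [- h2 (d1 e)] is the new witness. *)
Lemma biboundary_zigzag p q c :
  biboundary p.+1 q c -> biboundary p q.+1 (zigzag c).
Proof.
move=> [e Pe ->]; rewrite /zigzag /=; have Pd1e := Pd1 Pe.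
have /(canRL (addKr _)) := d2h2 Pd1e; rewrite d1d2 => ->.
exists (- h2 (d1 e)); last by rewrite linearD linearN d1d1 addr0 !linearN.
have [P0 PL] := PB p.+1 q.+2; move: (PL (-1) (h2 (d1 e)) 0).
rewrite addr0 scaleN1r => PL1; apply/asboolP/PL1 => //; apply/asboolP.
exact: Ph2.
Qed.

(* With y = h2 c: d2 (h1 (d1 y)) = d2 (y - d1 (h1 y)) = c - d1 (d2 (h1 y)). *)
Lemma zigzagK p q c : bicycle p.+1 q c ->
  biboundary p.+1 q (d2 (h1 (zigzag c)) - c).
Proof.
move=> [Pc d1c d2c]; have Ph2c := Ph2 Pc.
have d2h2c : d2 (h2 c) = c by rewrite -{2}(d2h2 Pc) d2c linear0 addr0.
rewrite /zigzag /=; have /(canRL (addKr _)) := d1h1 Ph2c => ->.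
rewrite linearD linearN d2h2c addrK -d1d2; apply: biboundaryN.
by exists (h1 (h2 c)); [exact: Ph1 | rewrite d1d2].
Qed.

End Bicomplex.

Section ZigzagIter.
Variables (k : fieldType) (M : lmodType k).
Variables (P : nat -> nat -> M -> Prop) (d1 d2 h1 h2 : {linear M -> M}).
Hypothesis PB : forall p q, submod_closed (fun c => `[< P p q c >]).
Hypothesis Pd1 : forall p q c, P p.+1 q c -> P p q (d1 c).
Hypothesis Pd2 : forall p q c, P p q.+1 c -> P p q (d2 c).
Hypothesis Ph1 : forall p q c, P p q.+1 c -> P p.+1 q.+1 (h1 c).
Hypothesis Ph2 : forall p q c, P p.+1 q c -> P p.+1 q.+1 (h2 c).
Hypothesis d1d1 : forall c, d1 (d1 c) = 0.
Hypothesis d2d2 : forall c, d2 (d2 c) = 0.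
Hypothesis d1d2 : forall c, d1 (d2 c) = d2 (d1 c).
Hypothesis d1h1 : forall p q c, P p q.+1 c -> d1 (h1 c) + h1 (d1 c) = c.
Hypothesis d2h2 : forall p q c, P p.+1 q c -> d2 (h2 c) + h2 (d2 c) = c.

Local Notation s := (zigzag d1 h2).
Local Notation s' := (zigzag d2 h1).
Local Notation bicyc := (bicycle P d1 d2).
Local Notation bibound := (biboundary P d1 d2).

Lemma bicycle_iter n p q c :
  bicyc (n + p) q c -> bicyc p (n + q) (iter n s c).
Proof.
elim: n p q c => // n IH p q c bc; rewrite iterSr addSnnS.
by apply: IH; apply: bicycle_zigzag bc.
Qed.

Lemma biboundary_iter n p q c :
  bibound (n + p) q c -> bibound p (n + q) (iter n s c).
Proof.
elim: n p q c => // n IH p q c bc; rewrite iterSr addSnnS.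
by apply: IH; apply: biboundary_zigzag bc.
Qed.

(** Peel off the innermost pair: the difference is [s'] of the error for [s c], a biboundary by
    induction, plus [s' (s c) - c], which [zigzagK] handles. *)
Lemma iter_zigzagK n p q c : bicyc (n + p) q c ->
  bibound (n + p) q (iter n s' (iter n s c) - c).
Proof.
elim: n p q c => [|n IH] p q c bc.
  have [P0 _] := PB p.+1 q.+1.
  by exists 0; [exact/asboolP | rewrite /= !linear0 subrr].
rewrite [iter n.+1 s c]iterSr [iter n.+1 s' _]iterS.
have scb : bicyc (n + p) q.+1 (s c) by apply: bicycle_zigzag bc.
have Bs := IH _ _ _ scb.
rewrite -[iter n s' _](subrK (s c)) linearD -addrA.
apply: biboundaryD => //; last exact: zigzagK bc.
have [e Pe eE] := Bs; rewrite eE /=.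
(* [s'] is the zigzag of the transposed double complex, so the biboundary is first rewritten with
   the two differentials exchanged. *)
have Be : biboundary (fun p q => P q p) d2 d1 q.+1 (n + p) (d1 (d2 e)) by
  exists e; rewrite // d1d2.
have [e' Pe' ->] := biboundary_zigzag (P := fun p q => P q p) (h2 := h1)
  (fun p q => PB q p) (fun p q => @Pd2 q p) (fun p q => @Ph1 q p) d2d2
  (fun c => esym (d1d2 c)) (fun p q => @d1h1 q p) Be.
by exists e'; rewrite // d1d2.
Qed.

End ZigzagIter.

(** * The edge of the double complex as the chain complex of [K] *)

Section Corner.
Variables (k : fieldType) (disp : Order.disp_t) (V : orderType disp).
Variable (K : simplicial_complex V) (M : lmodType k).
Variables (P : nat -> nat -> M -> Prop) (d1 d2 h2 : {linear M -> M}).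
Variables (inj : {linear {malg k[{fset V}]} -> M}).
Variables (proj : {linear M -> {malg k[{fset V}]}}).
Hypothesis Pd2 : forall p q c, P p q.+1 c -> P p q (d2 c).
Hypothesis Ph2 : forall p q c, P p.+1 q c -> P p.+1 q.+1 (h2 c).
Hypothesis d2h2 : forall p q c, P p.+1 q c -> d2 (h2 c) + h2 (d2 c) = c.
Hypothesis inj_chain : forall n c, is_chain K n c -> P n 0 (inj c).
Hypothesis proj_chain : forall n y, P n 0 y -> is_chain K n (proj y).
Hypothesis injK : forall c, proj (inj c) = c.
Hypothesis projK : forall n y, P n 0 y -> inj (proj y) = y.
Hypothesis d1_inj : forall c, d1 (inj c) = inj (boundary c).
Hypothesis d2_inj : forall c, d2 (inj c) = 0.

Lemma bicycle_inj i c : is_cycle K i c -> bicycle P d1 d2 i.+1 0 (inj c).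
Proof.
move=> /asboolP[Kc c0]; split; first exact: inj_chain.
  by rewrite d1_inj c0 linear0.
exact: d2_inj.
Qed.

Lemma cycle_proj i y : bicycle P d1 d2 i.+1 0 y -> is_cycle K i (proj y).
Proof.
move=> [Py d1y _]; apply/asboolP; split; first exact: proj_chain.
by rewrite -[LHS]injK -d1_inj (projK Py) d1y linear0.
Qed.

(** [d2] kills [inj c], so the contraction makes [inj c] equal to [d2 (h2 (inj c))]; applying [d1]
    gives the biboundary. *)
Lemma biboundary_inj i c :
  is_chain K i.+2 c -> biboundary P d1 d2 i.+1 0 (inj (boundary c)).
Proof.
move=> /inj_chain Pc; exists (h2 (inj c)); first exact: Ph2.
by have := d2h2 Pc; rewrite d2_inj linear0 addr0 => ->.
Qed.

(** The element [d2 e] already lies on the edge, where [d1] is the simplicial boundary. *)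
Lemma boundary_proj i y : biboundary P d1 d2 i.+1 0 y ->
  exists2 c, is_chain K i.+2 c & proj y = boundary c.
Proof.
move=> [e /Pd2 Pe ->]; exists (proj (d2 e)); first exact: proj_chain.
by rewrite -{1}(projK Pe) d1_inj injK.
Qed.

End Corner.

Section IterLinear.
Variables (k : fieldType) (M : lmodType k) (f : {linear M -> M}) (n : nat).

Lemma iter_linear : linear (iter n f).
Proof. by elim: n => // m IH a x y /=; rewrite IH linearP. Qed.

HB.instance Definition _ := GRing.isLinear.Build k M M *:%R (iter n f)
  iter_linear.

End IterLinear.

(** * The double complex spanned by pairs of faces *)

HB.lock Definition tens (k : fieldType) (V W : choiceType) (G : W)
    (a : {malg k[V]}) : {malg k[(V * W)%type]} :=
  lin_ext (fun F => gen k (F, G)) a.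
HB.lock Definition fst_chain (k : fieldType) (V W : choiceType)
    (c : {malg k[(V * W)%type]}) : {malg k[V]} :=
  lin_ext (fun FG => gen k FG.1) c.
HB.lock Definition swap_chain (k : fieldType) (V W : choiceType)
    (c : {malg k[(V * W)%type]}) : {malg k[(W * V)%type]} :=
  lin_ext (fun FG => gen k (FG.2, FG.1)) c.
HB.lock Definition dleft (k : fieldType) (disp : Order.disp_t)
    (V : orderType disp) (W : choiceType)
    (c : {malg k[({fset V} * W)%type]}) : {malg k[({fset V} * W)%type]} :=
  lin_ext (fun FG => tens FG.2 (boundary_face k FG.1)) c.

Definition cone_opt (k : fieldType) (disp : Order.disp_t) (V : orderType disp)
    (x : option V) (F : {fset V}) : {malg k[{fset V}]} :=
  if x is Some y then cone_face k y F else 0.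

(** The apex may vary with the second component, because [dleft] never changes that component;
    [None] marks a component over which no cone is taken. *)
HB.lock Definition hleft (k : fieldType) (disp : Order.disp_t)
    (V : orderType disp) (W : choiceType) (apex : W -> option V)
    (c : {malg k[({fset V} * W)%type]}) : {malg k[({fset V} * W)%type]} :=
  lin_ext (fun FG => tens FG.2 (cone_opt k (apex FG.2) FG.1)) c.

Section Swap.
Variables (k : fieldType) (V W : choiceType).
Implicit Types (F : V) (G : W) (a : {malg k[V]}) (c : {malg k[(V * W)%type]}).

Lemma tens_linear G : linear (@tens k V W G).
Proof. by rewrite tens.unlock; apply: lin_ext_linear. Qed.
HB.instance Definition _ G := GRing.isLinear.Build k _ _ *:%R (@tens k V W G)
  (tens_linear G).

Lemma fst_chain_linear : linear (@fst_chain k V W).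
Proof. by rewrite fst_chain.unlock; apply: lin_ext_linear. Qed.
HB.instance Definition _ := GRing.isLinear.Build k _ _ *:%R
  (@fst_chain k V W) fst_chain_linear.

Lemma swap_chain_linear : linear (@swap_chain k V W).
Proof. by rewrite swap_chain.unlock; apply: lin_ext_linear. Qed.
HB.instance Definition _ := GRing.isLinear.Build k _ _ *:%R
  (@swap_chain k V W) swap_chain_linear.

Lemma tens_gen F G : tens G (gen k F) = gen k (F, G).
Proof. by rewrite tens.unlock lin_ext_gen. Qed.

Lemma fst_chain_gen F G : fst_chain (gen k (F, G)) = gen k F.
Proof. by rewrite fst_chain.unlock lin_ext_gen. Qed.

Lemma swap_chain_gen F G : swap_chain (gen k (F, G)) = gen k (G, F).
Proof. by rewrite swap_chain.unlock lin_ext_gen. Qed.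

Lemma tensK G : cancel (@tens k V W G) (@fst_chain k V W).
Proof.
move=> a; apply: (@eq_linear_malg _ _ _ (@fst_chain k V W \o @tens k V W G)
  idfun) => F _ /=.
by rewrite tens_gen fst_chain_gen.
Qed.

Lemma fst_chainK G c : supp_in (fun FG => FG.2 = G) c ->
  tens G (fst_chain c) = c.
Proof.
move=> cG; apply: (@eq_linear_malg _ _ _ (@tens k V W G \o @fst_chain k V W)
  idfun).
by move=> [F G'] /cG /= ->; rewrite fst_chain_gen tens_gen.
Qed.

Lemma supp_in_tens (P : V * W -> Prop) G a :
  supp_in (fun F => P (F, G)) a -> supp_in P (tens G a).
Proof.
by move=> Pa; rewrite tens.unlock; apply: supp_in_lin_ext => F /Pa;
  apply: supp_in_gen.
Qed.

Lemma supp_in_fst_chain (P : V -> Prop) c :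
  supp_in (fun FG => P FG.1) c -> supp_in P (fst_chain c).
Proof.
by move=> Pc; rewrite fst_chain.unlock; apply: supp_in_lin_ext => FG /Pc;
  apply: supp_in_gen.
Qed.

Lemma supp_in_swap_chain (P : W * V -> Prop) c :
  supp_in (fun FG => P (FG.2, FG.1)) c -> supp_in P (swap_chain c).
Proof.
by move=> Pc; rewrite swap_chain.unlock; apply: supp_in_lin_ext => FG /Pc;
  apply: supp_in_gen.
Qed.

End Swap.

Section DoubleChain.
Variables (k : fieldType) (disp : Order.disp_t).
Variables (V : orderType disp) (W : choiceType) (apex : W -> option V).

Local Notation bichain := {malg k[({fset V} * W)%type]}.
Local Notation chain := {malg k[{fset V}]}.
Implicit Types (F : {fset V}) (G : W) (c : bichain) (a : chain).
Local Notation tens := (@tens k {fset V} W).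
Local Notation dleft := (@dleft k disp V W).
Local Notation hleft := (@hleft k disp V W apex).

Lemma dleft_linear : linear dleft.
Proof. by rewrite dleft.unlock; apply: lin_ext_linear. Qed.
HB.instance Definition _ := GRing.isLinear.Build k bichain bichain *:%R dleft
  dleft_linear.

Lemma hleft_linear : linear hleft.
Proof. by rewrite hleft.unlock; apply: lin_ext_linear. Qed.
HB.instance Definition _ := GRing.isLinear.Build k bichain bichain *:%R hleft
  hleft_linear.

Lemma dleft_tens G a : dleft (tens G a) = tens G (boundary a).
Proof.
apply: (@eq_linear_malg _ _ _ (dleft \o tens G) (tens G \o @boundary k disp V)).
by move=> F _ /=; rewrite tens_gen boundary_gen dleft.unlock lin_ext_gen.
Qed.

Lemma hleft_tens G a :
  hleft (tens G a) = tens G (lin_ext (cone_opt k (apex G)) a).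
Proof.
apply: (@eq_linear_malg _ _ _ (hleft \o tens G)
  (tens G \o lin_ext (cone_opt k (apex G)))).
by move=> F _ /=; rewrite tens_gen hleft.unlock !lin_ext_gen.
Qed.

Lemma dleftK c : dleft (dleft c) = 0.
Proof.
rewrite -[RHS]/((\0 : {linear bichain -> bichain}) c).
apply: (@eq_linear_malg _ _ _ (dleft \o dleft)) => -[F G] _ /=.
by rewrite -tens_gen (dleft_tens G (gen k F)) dleft_tens boundaryK linear0.
Qed.

(** With the second component [G] fixed, this is [boundary_cone] at the vertex [apex G]. *)
Lemma dleft_hleft c :
    (forall FG, FG \in monalg.msupp c -> apex FG.2 != None) ->
  dleft (hleft c) + hleft (dleft c) = c.
Proof.
move=> apexP; apply: (@eq_linear_malg _ _ _
  ((dleft \o hleft) \+ (hleft \o dleft)) idfun) => -[F G] /apexP /=.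
rewrite -tens_gen hleft_tens (dleft_tens G (gen k F)) dleft_tens hleft_tens.
rewrite -(linearD (tens G)).
by case: (apex G) => //= x _; rewrite boundary_cone.
Qed.

Lemma supp_in_dleft (P : {fset V} * W -> Prop) c :
    supp_in (fun FG : {fset V} * W => forall x, x \in FG.1 ->
      P (FG.1 `\ x, FG.2)) c ->
  supp_in P (dleft c).
Proof.
move=> Pc; rewrite dleft.unlock; apply: supp_in_lin_ext => -[F G] /Pc /= PFG.
rewrite boundary_faceE; apply: supp_in_tens; apply: supp_in_sum => x Fx.
by apply: supp_inZ; apply: supp_in_gen; apply: PFG.
Qed.

Lemma supp_in_hleft (P : {fset V} * W -> Prop) c :
    supp_in (fun FG : {fset V} * W => forall x, apex FG.2 = Some x ->
      x \notin FG.1 ->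
      P (x |` FG.1, FG.2)) c ->
  supp_in P (hleft c).
Proof.
move=> Pc; rewrite hleft.unlock; apply: supp_in_lin_ext => -[F G] /Pc /= PFG.
apply: supp_in_tens; case: (apex G) PFG => [x|] /= PFG; last exact: supp_in0.
rewrite /cone_face; case: ifPn => [_|Fx]; first exact: supp_in0.
by apply: supp_inZ; apply: supp_in_gen; apply: PFG.
Qed.

End DoubleChain.

Lemma swap_chainK (k : fieldType) (T U : choiceType) :
  cancel (@swap_chain k T U) (@swap_chain k U T).
Proof.
move=> c; apply: (@eq_linear_malg _ _ _ (@swap_chain k U T \o @swap_chain k T U)
  idfun) => -[F G] _ /=.
by rewrite !swap_chain_gen.
Qed.

Section DoubleChainCommute.
Variables (k : fieldType) (d1 d2 : Order.disp_t).
Variables (V : orderType d1) (W : orderType d2).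

Local Notation bichain := {malg k[({fset V} * {fset W})%type]}.
Local Notation swap := (@swap_chain k {fset V} {fset W}).
Local Notation swap' := (@swap_chain k {fset W} {fset V}).

(** Conjugating by the swap transfers every fact about [dleft]. No sign depending on the first
    component is inserted, so the two differentials commute instead of anticommuting. *)
Definition dright : bichain -> bichain :=
  swap' \o @dleft k d2 W {fset V} \o swap.
HB.instance Definition _ := GRing.Linear.on dright.

Definition hright apex : bichain -> bichain :=
  swap' \o @hleft k d2 W {fset V} apex \o swap.
HB.instance Definition _ apex := GRing.Linear.on (hright apex).

Lemma dleft_gen F G : @dleft k d1 V {fset W} (gen k (F, G)) =
  \sum_(x <- F) face_sign k x F *: gen k (F `\ x, G).
Proof.
rewrite dleft.unlock lin_ext_gen boundary_faceE linear_sum;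
  apply: eq_bigr => x _ /=.
by rewrite linearZ /= tens_gen.
Qed.

Lemma dright_gen F G : dright (gen k (F, G)) =
  \sum_(y <- G) face_sign k y G *: gen k (F, G `\ y).
Proof.
rewrite /dright /= swap_chain_gen dleft.unlock lin_ext_gen boundary_faceE
  !linear_sum /=.
by apply: eq_bigr => y _; rewrite !linearZ /= tens_gen swap_chain_gen.
Qed.

Lemma dleft_dright c : @dleft k d1 V {fset W} (dright c) = dright (@dleft k d1
  V {fset W} c).
Proof.
apply: (@eq_linear_malg _ _ _ (@dleft k d1 V {fset W} \o dright)
  (dright \o @dleft k d1 V {fset W})) => -[F G] _ /=.
rewrite dright_gen dleft_gen !linear_sum /=.
under eq_bigr => y _ do rewrite linearZ /= dleft_gen scaler_sumr.
rewrite exchange_big; apply: eq_bigr => x _ /=.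
rewrite [RHS]linearZ /= dright_gen scaler_sumr; apply: eq_bigr => y _.
by rewrite !scalerA mulrC.
Qed.

End DoubleChainCommute.

(** * Dowker duality *)

Section DowkerLeft.
Variables (k : fieldType) (d1 d2 : Order.disp_t).
Variables (V : orderType d1) (W : orderType d2).
Variables (K : simplicial_complex V) (L : simplicial_complex W).
Variable R : V -> W -> Prop.

(** When one component is empty the condition on [R] is vacuous, and the requirements [K] and [L]
    make the edges of the double complex consist of exactly the faces of [K] and of [L]. *)
Definition bisimplex p q (FG : {fset V} * {fset W}) : Prop :=
  [/\ #|` FG.1| = p, #|` FG.2| = q, K FG.1, L FG.2 &
      forall x y, x \in FG.1 -> y \in FG.2 -> R x y].

Hypothesis K_face : forall F, F != fset0 ->
  K F <-> exists y, forall x, x \in F -> R x y.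
Hypothesis L_face : forall G, G != fset0 ->
  L G <-> exists x, forall y, y \in G -> R x y.

(** A common neighbour is chosen for each nonempty face. [None] covers the sets that are not faces,
    and the empty set, for which [V] might have no vertex to offer. *)
Lemma ex_apex : exists apex : {fset W} -> option V,
  forall G, (forall x, apex G = Some x -> forall y, y \in G -> R x y) /\
            (G != fset0 -> L G -> apex G != None).
Proof.
pose P (G : {fset W}) (o : option V) := (forall x, o = Some x ->
  forall y, y \in G -> R x y)
  /\ (G != fset0 -> L G -> o != None).
have /choice[f fP] : forall G, exists o, P G o.
  move=> G; have [G0|G0] := eqVneq G fset0; first by exists None; split=> //;
    rewrite G0 eqxx.
  have [/(L_face G0)[x Rx]|nL] := pselect (L G); last by exists None; split.
  by exists (Some x); split=> // x' [<-].
by exists f.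
Qed.

Variable apex : {fset W} -> option V.
Hypothesis apexP : forall G,
  (forall x, apex G = Some x -> forall y, y \in G -> R x y) /\
  (G != fset0 -> L G -> apex G != None).

Lemma bisimplex_dleft p q (c : {malg k[({fset V} * {fset W})%type]}) :
  supp_in (bisimplex p.+1 q) c -> supp_in (bisimplex p q) (dleft c).
Proof.
move=> Pc; apply: supp_in_dleft => -[F G] /Pc [/= cF cG KF LG RFG] x Fx.
split=> //=.
- by move: cF; rewrite (cardfsD1 x) Fx => -[].
- by apply: face_sub KF; apply: fsubD1set.
- by move=> x' y; rewrite !inE => /andP[_ Fx']; apply: RFG.
Qed.

Lemma bisimplex_hleft p q (c : {malg k[({fset V} * {fset W})%type]}) :
  supp_in (bisimplex p q.+1) c -> supp_in (bisimplex p.+1 q.+1) (hleft apex c).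
Proof.
move=> Pc; apply: supp_in_hleft => -[F G] /Pc [/= cF cG KF LG RFG] x xG Fx.
have RxG := (apexP G).1 _ xG.
have RxFG x' y : x' \in x |` F -> y \in G -> R x' y.
  by rewrite !inE => /orP[/eqP -> /RxG //|]; apply: RFG.
split=> //=; first by rewrite cardfsU1 Fx cF.
(* Here the positive second index matters: any element of [G] is a common neighbour of the enlarged
   first component, which is therefore a face of [K]. *)
have /fset0Pn[y Gy] : G != fset0 by rewrite -cardfs_gt0 cG.
apply/K_face; last by exists y => x' /RxFG; apply.
by apply/fset0Pn; exists x; rewrite !inE eqxx.
Qed.

Lemma dleft_hleft_bisimplex p q (c : {malg k[({fset V} * {fset W})%type]}) :
  supp_in (bisimplex p q.+1) c -> dleft (hleft apex c) + hleft apex (dleft c) =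
    c.
Proof.
move=> Pc; apply: dleft_hleft => -[F G] /Pc [/= _ cG _ LG _].
case aG: (apex G) => [//|].
have G0 : G != fset0 by rewrite -cardfs_gt0 cG.
by have := (apexP G).2 G0 LG; rewrite aG.
Qed.

End DowkerLeft.

Lemma dleft_fset0 (k : fieldType) (disp : Order.disp_t) (V : orderType disp)
    (W : choiceType) (c : {malg k[({fset V} * W)%type]}) :
  supp_in (fun FG => FG.1 = fset0) c -> dleft c = 0.
Proof.
move=> c0; apply: (@eq_linear_malg _ _ _ (@dleft k disp V W) \0).
by move=> -[F G] /c0 /= ->; rewrite -tens_gen dleft_tens boundary_gen
  boundary_faceE big_seq_fset0 linear0.
Qed.

Section Dowker.
Variables (k : fieldType) (d1 d2 : Order.disp_t).
Variables (V : orderType d1) (W : orderType d2).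
Variables (K : simplicial_complex V) (L : simplicial_complex W).
Variable R : V -> W -> Prop.
Hypothesis K_face : forall F, F != fset0 ->
  K F <-> exists y, forall x, x \in F -> R x y.
Hypothesis L_face : forall G, G != fset0 ->
  L G <-> exists x, forall y, y \in G -> R x y.

Local Notation bichain := {malg k[({fset V} * {fset W})%type]}.
Local Notation swap := (@swap_chain k {fset V} {fset W}).
Local Notation swap' := (@swap_chain k {fset W} {fset V}).
Local Notation P := (fun p q (c : bichain) => supp_in (bisimplex K L R p q) c).
Local Notation P' := (fun q p c => supp_in (bisimplex L K (fun y x =>
  R x y) q p) c).

Local Notation Q := (fun p q => P q p).

Lemma supp_bisimplex_submod p q : submod_closed (fun c => `[< P p q c >]).
Proof.
split=> [|b c e /asboolP Pc /asboolP Pe]; apply/asboolP; first exact: supp_in0.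
by apply: supp_inD => //; apply: supp_inZ.
Qed.

Lemma swap_bisimplex p q c : P p q c -> P' q p (swap c).
Proof.
move=> Pc; apply: supp_in_swap_chain => FG /Pc [? ? ? ? RFG];
  split=> //= y x Gy Fx.
exact: RFG.
Qed.

Lemma swap_bisimplex' p q c : P' q p c -> P p q (swap' c).
Proof.
move=> Pc; apply: supp_in_swap_chain => FG /Pc [? ? ? ? RFG];
  split=> //= y x Gy Fx.
exact: RFG.
Qed.

Lemma dowker_homology_iso i :
  exists h : {linear reduced_homology k K i -> reduced_homology k L i},
    bijective h.
Proof.
have [ap1 ap1P] := ex_apex L_face.
have [ap2 ap2P] := ex_apex K_face.
pose b1 : {linear bichain -> bichain} := @dleft k d1 V {fset W}.
pose b2 : {linear bichain -> bichain} := @dright k d1 d2 V W.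
pose c1 : {linear bichain -> bichain} := hleft ap1.
pose c2 : {linear bichain -> bichain} := @hright k d1 d2 V W ap2.
have Pb1 p q c : P p.+1 q c -> P p q (b1 c) by apply: bisimplex_dleft.
have Pc1 p q c : P p q.+1 c -> P p.+1 q.+1 (c1 c).
  exact: bisimplex_hleft.
have bc1 p q c : P p q.+1 c -> b1 (c1 c) + c1 (b1 c) = c.
  exact: dleft_hleft_bisimplex.
have Pb2 p q c : P p q.+1 c -> P p q (b2 c).
  by move=> Pc; apply/swap_bisimplex'/bisimplex_dleft/swap_bisimplex.
have Pc2 p q c : P p.+1 q c -> P p.+1 q.+1 (c2 c).
  by move=> Pc; apply/swap_bisimplex'/bisimplex_hleft/swap_bisimplex.
have bc2 p q c : P p.+1 q c -> b2 (c2 c) + c2 (b2 c) = c.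
  move=> /swap_bisimplex Pc; rewrite /b2 /c2 /= /dright /hright /= !swap_chainK
    -linearD.
  by rewrite (dleft_hleft_bisimplex ap2P Pc); apply: swap_chainK.
have bb1 c : b1 (b1 c) = 0 by apply: dleftK.
have bb2 c : b2 (b2 c) = 0 by rewrite /b2 /= /dright /= swap_chainK dleftK
  linear0.
have b12 c : b1 (b2 c) = b2 (b1 c) by apply: dleft_dright.
(* Chains of [K] are the bichains whose second component is empty, chains of [L] those whose first
   component is empty. *)
pose j1 : {linear {malg k[{fset V}]} -> bichain} := tens (fset0 : {fset W}).
pose p1 : {linear bichain -> {malg k[{fset V}]}} :=
  @fst_chain k {fset V} {fset W}.
pose j2 : {linear {malg k[{fset W}]} ->
  bichain} := swap' \o tens (fset0 : {fset V}).
pose p2 : {linear bichain -> {malg k[{fset W}]}} :=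
  @fst_chain k {fset W} {fset V} \o swap.
have p1K c : p1 (j1 c) = c by apply: tensK.
have p2K c : p2 (j2 c) = c by rewrite /p2 /j2 /= swap_chainK tensK.
have j1K n y : P n 0 y -> j1 (p1 y) = y.
  by move=> Py; apply: fst_chainK => FG /Py [_ /cardfs0_eq].
have j2K n y : P 0 n y -> j2 (p2 y) = y.
  move=> /swap_bisimplex Py; rewrite /p2 /j2 /= fst_chainK ?swap_chainK //.
  by move=> FG /Py [_ /cardfs0_eq].
have Pj1 n c : is_chain K n c -> P n 0 (j1 c).
  move=> Kc; apply: supp_in_tens => F /Kc[cF KF]; split=> //=.
  exact: face_fset0.
have Pj2 n c : is_chain L n c -> P 0 n (j2 c).
  move=> Lc; apply: swap_bisimplex'; apply: supp_in_tens => G /Lc[cG LG];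
    split=> //=.
  exact: face_fset0.
have Pp1 n y : P n 0 y -> is_chain K n (p1 y).
  by move=> Py; apply: supp_in_fst_chain => FG /Py [].
have Pp2 n y : P 0 n y -> is_chain L n (p2 y).
  by move=> /swap_bisimplex Py; apply: supp_in_fst_chain => FG /Py [].
have b1j1 c : b1 (j1 c) = j1 (boundary c) by apply: dleft_tens.
have b2j2 c : b2 (j2 c) = j2 (boundary c).
  by rewrite /b2 /j2 /= /dright /= swap_chainK dleft_tens.
have b2j1 c : b2 (j1 c) = 0.
  rewrite /b2 /j1 /= /dright /= dleft_fset0 ?linear0 //.
  by apply: supp_in_swap_chain; apply: supp_in_tens.
have b1j2 c : b1 (j2 c) = 0.
  by apply: dleft_fset0; apply: supp_in_swap_chain; apply: supp_in_tens.
(* Faces of dimension [i] have [i.+1] vertices, so [i.+1] zigzags lead from bidegree (i + 1, 0) on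
   one edge to (0, i + 1) on the other. *)
pose s := zigzag b1 c2; pose s' := zigzag b2 c1.
pose f : {linear {malg k[{fset V}]} ->
  {malg k[{fset W}]}} := p2 \o iter i.+1 s \o j1.
pose g : {linear {malg k[{fset W}]} ->
  {malg k[{fset V}]}} := p1 \o iter i.+1 s' \o j2.
pose PB := supp_bisimplex_submod.
(* The transposed data satisfy the same hypotheses, which gives the reverse zigzag its
   properties. *)
have b21 c : b2 (b1 c) = b1 (b2 c) by [].
have QB p q : submod_closed (fun c => `[< Q p q c >]) by apply: PB.
have Qb1 p q c : Q p q.+1 c -> Q p q (b1 c) by apply: Pb1.
have Qb2 p q c : Q p.+1 q c -> Q p q (b2 c) by apply: Pb2.
have Qc1 p q c : Q p.+1 q c -> Q p.+1 q.+1 (c1 c) by apply: Pc1.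
have Qc2 p q c : Q p q.+1 c -> Q p.+1 q.+1 (c2 c) by apply: Pc2.
have bc1' p q c : Q p.+1 q c -> b1 (c1 c) + c1 (b1 c) = c by apply: bc1.
have bc2' p q c : Q p q.+1 c -> b2 (c2 c) + c2 (b2 c) = c by apply: bc2.
have fE c : f c = p2 (iter i.+1 s (j1 c)) by [].
have gE c : g c = p1 (iter i.+1 s' (j2 c)) by [].
have sB c : biboundary P b1 b2 i.+1 0 c ->
  biboundary Q b2 b1 i.+1 0 (iter i.+1 s c).
  rewrite -{1}[i.+1]addn0 => Bc.
  have [e Pe ->] := biboundary_iter PB Pb1 Pc2 bb1 b12 bc2 Bc.
  by exists e; rewrite ?b12 // -[i.+1]addn0.
have sZ c : bicycle P b1 b2 i.+1 0 c -> bicycle Q b2 b1 i.+1 0 (iter i.+1 s c).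
  rewrite -{1}[i.+1]addn0 => Zc.
  have [] := bicycle_iter Pb1 Pc2 bb1 b12 bc2 Zc.
  by rewrite addn0.
have s'B c : biboundary Q b2 b1 i.+1 0 c ->
  biboundary P b1 b2 i.+1 0 (iter i.+1 s' c).
  rewrite -{1}[i.+1]addn0 => Bc.
  have [e Pe ->] := biboundary_iter QB Qb2 Qc1 bb2 b21 bc1' Bc.
  by exists e; rewrite ?b12 // -[i.+1]addn0.
have s'Z c : bicycle Q b2 b1 i.+1 0 c ->
  bicycle P b1 b2 i.+1 0 (iter i.+1 s' c).
  rewrite -{1}[i.+1]addn0 => Zc.
  have [] := bicycle_iter Qb2 Qc1 bb2 b21 bc1' Zc.
  by rewrite addn0.
have ss' c : bicycle P b1 b2 i.+1 0 c ->
  biboundary P b1 b2 i.+1 0 (iter i.+1 s' (iter i.+1 s c) - c).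
  rewrite -{1 2}[i.+1]addn0 => Zc.
  exact: (iter_zigzagK PB Pb1 Pb2 Pc1 Pc2 bb1 bb2 b12 bc1 bc2 Zc).
have s's c : bicycle Q b2 b1 i.+1 0 c ->
  biboundary Q b2 b1 i.+1 0 (iter i.+1 s (iter i.+1 s' c) - c).
  rewrite -{1 2}[i.+1]addn0 => Zc.
  exact: (iter_zigzagK QB Qb2 Qb1 Qc2 Qc1 bb2 bb1 b21 bc2' bc1' Zc).
apply: (homology_iso (f := f) (g := g)) => c.
- move=> /(bicycle_inj Pj1 b1j1 b2j1) /sZ.
  exact: (cycle_proj (P := Q) Pp2 p2K j2K b2j2).
- move=> /(bicycle_inj (P := Q) Pj2 b2j2 b1j2) /s'Z.
  exact: (cycle_proj (P := P) Pp1 p1K j1K b1j1).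
- move=> /(biboundary_inj Pc2 bc2 Pj1 b1j1 b2j1) /sB.
  exact: (boundary_proj (P := Q) Qb1 Pp2 p2K j2K b2j2).
- move=> /(biboundary_inj (P := Q) Qc1 bc1' Pj2 b2j2 b1j2) /s'B.
  exact: (boundary_proj (P := P) Pb2 Pp1 p1K j1K b1j1).
- move=> Zc; rewrite fE gE.
  have Bc := bicycle_inj (P := P) Pj1 b1j1 b2j1 Zc.
  (* The iterated zigzag ends on the edge of [L], where [j2] undoes [p2]; so [g (f c)] is [p1] of
     the full round trip of [j1 c]. *)
  have [Py _ _] := sZ _ Bc.
  rewrite (j2K _ _ Py) -{2}[c]p1K -linearB.
  exact: (boundary_proj (P := P) Pb2 Pp1 p1K j1K b1j1 (ss' _ Bc)).
- move=> Zc; rewrite fE gE.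
  have Bc := bicycle_inj (P := Q) Pj2 b2j2 b1j2 Zc.
  have [Py _ _] := s'Z _ Bc.
  rewrite (j1K _ _ Py) -{2}[c]p2K -linearB.
  exact: (boundary_proj (P := Q) Qb1 Pp2 p2K j2K b2j2 (s's _ Bc)).
Qed.

End Dowker.

(** * Normal forms and the faces of the two complexes *)

Section Dickson.

Lemma nondecreasing_subseq (g : nat -> nat) : exists phi : nat -> nat,
  {homo phi : i j / (i < j)%N} /\ {homo g \o phi : i j / (i <= j)%N}.
Proof.
(* [next N] is a position from [N] on where [g] attains its minimum over that tail; minima over
   shrinking tails cannot decrease. *)
have /choice[next nextP] : forall N, exists m,
    (N <= m)%N /\ forall j, (N <= j)%N -> (g m <= g j)%N.
  move=> N; have ex : exists x, `[< exists2 m, (N <= m)%N & g m = x >].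
    by exists (g N); apply/asboolP; exists N.
  have [x /asboolP[m Nm <-] xmin] := ex_minnP ex; exists m; split=> // j Nj.
  by apply: xmin; apply/asboolP; exists j.
pose phi := fix phi i := if i is i'.+1 then next (phi i').+1 else next 0%N.
have phiS i : (phi i < phi i.+1)%N by case: (nextP (phi i).+1).
have phi_lt : {homo phi : i j / (i < j)%N}.
  by apply: homo_ltn => //; apply: ltn_trans.
exists phi; split=> //.
apply: homo_leq => [//||i]; first exact: leq_trans.
case: i => [|i] /=; first by apply: (nextP 0%N).2.
apply: (nextP (phi i).+1).2; apply: leq_trans (ltnW (phiS i.+1)).
exact: phiS.
Qed.

(** Subsequences are extracted one coordinate at a time: after [m] rounds the first [m] coordinates
    are nondecreasing. *)
Lemma dickson n (f : nat -> 'X_{1..n}) :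
  exists i j, (i < j)%N /\ (f i <= f j)%MM.
Proof.
suff /(_ n)[phi [phi_lt phi_le]] : forall m, exists phi : nat -> nat,
    {homo phi : i j / (i < j)%N} /\
    forall c : 'I_n, (c < m)%N -> {homo (fun i =>
      f (phi i) c) : i j / (i <= j)%N}.
  exists (phi 0%N), (phi 1%N); split; first exact: phi_lt.
  by apply/mnm_lepP => c; apply: (phi_le c (ltn_ord c) 0%N 1%N).
elim=> [|m [phi [phi_lt phi_le]]]; first by exists id; split.
have [mn|mn] := ltnP m n; last first.
  exists phi; split=> // c _; apply: phi_le; exact: leq_trans (ltn_ord c) mn.
have [psi [psi_lt psi_le]] := nondecreasing_subseq (fun i =>
  f (phi i) (Ordinal mn)).
exists (phi \o psi); split; first by move=> i j /psi_lt /phi_lt.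
move=> c; rewrite ltnS leq_eqVlt => /orP[/eqP cm|cm] i j ij.
  have -> : c = Ordinal mn by apply: val_inj.
  exact: psi_le.
apply: (phi_le c cm); move: ij; rewrite leq_eqVlt => /orP[/eqP -> //|/psi_lt].
exact: ltnW.
Qed.

(** Without a minimal element, choice yields an infinite strictly descending sequence in [A].
    Dickson's lemma finds two terms in it of which one divides the other; they coincide in an
    antichain, against irreflexivity. *)
Lemma antichain_min n (A : 'X_{1..n} -> Prop) (lt : 'X_{1..n} -> 'X_{1..n} ->
  Prop) :
    (forall m, ~ lt m m) -> (forall m1 m2 m3, lt m1 m2 -> lt m2 m3 ->
      lt m1 m3) ->
    (forall m m', A m -> A m' -> (m <= m')%MM -> m = m') ->
  forall m, A m -> exists2 m0, A m0 & forall m', A m' -> ~ lt m' m0.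
Proof.
move=> irr tr anti m Am; apply: contrapT => nmin.
have /choice[next nextP] : forall x : {x | A x}, exists y : {x | A x},
    lt (sval y) (sval x).
  move=> [x Ax] /=; apply: contrapT => nlt; apply: nmin; exists x => // y Ay yx.
  by apply: nlt; exists (exist _ y Ay).
pose f i := iter i next (exist _ m Am).
have fS i j : (i < j)%N -> lt (sval (f j)) (sval (f i)).
  elim: j => // j IH; rewrite ltnS leq_eqVlt => /orP[/eqP -> |/IH];
    first exact: nextP.
  exact: (tr _ _ _ (nextP _)).
have [i [j [ij fij]]] := dickson (fun i => sval (f i)).
have fE := anti _ _ (svalP (f i)) (svalP (f j)) fij.
by apply: (irr (sval (f i))); rewrite {1}fE; apply: fS.
Qed.

End Dickson.

Section NormalForm.
Variables (d n : nat) (a : 'I_n -> 'rV[int]_d).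
Hypothesis pa : pointed a.

Lemma degAB m m' : (m' <= m)%MM -> degA a (m - m') = degA a m - degA a m'.
Proof. by move=> /submK {2}<-; rewrite degAD addrK. Qed.

(** The quotient of the two monomials has degree 0, hence is trivial by pointedness. *)
Lemma degA_antichain m m' : degA a m = degA a m' -> (m <= m')%MM -> m = m'.
Proof.
move=> e mm'; have /pa m0 : degA a (m' - m) = 0 by rewrite degAB // e subrr.
by rewrite -(submK mm') m0 add0m.
Qed.

End NormalForm.

(** * Normal forms modulo the toric ideal *)

Section Toric.
Variables (k : fieldType) (d r s : nat) (a : 'I_(r + s) -> 'rV[int]_d).
Hypothesis pa : pointed a.
Variable le : rel 'I_(r + s).
Hypothesis le_order : variable_order le.

Local Notation mnm := 'X_{1..r + s}.

Definition tie_lt (m' m : mnm) : Prop :=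
  exists x, (m x < m' x)%N /\ forall y, le y x -> y != x -> m y = m' y.

Lemma revlexE m' m : degA a m' = degA a m -> revlex a le m' m <-> tie_lt m' m.
Proof.
move=> e; split=> [|lt_m]; last by right.
by case=> [[c []]|[_ //]]; rewrite e subrr mxE ltxx.
Qed.

Lemma tie_lt_irr m : ~ tie_lt m m.
Proof. by case=> x []; rewrite ltnn. Qed.

(** The smaller of the two deciding variables decides between [m1] and [m3]. *)
Lemma tie_lt_trans m1 m2 m3 : tie_lt m1 m2 -> tie_lt m2 m3 -> tie_lt m1 m3.
Proof.
have [anti tr tot _] := le_order.
move=> [x [ltx eqx]] [y [lty eqy]].
have [e|xy] := eqVneq x y.
  exists x; split=> [|z zx zx']; first by rewrite e in ltx *;
    apply: ltn_trans lty ltx.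
  by rewrite eqy ?eqx // -e.
have [lexy|leyx] := orP (tot x y).
  exists x; split=> [|z zx zx']; first by rewrite eqy.
  have zy : z != y.
    apply: contraNneq xy => zy.
    by apply/eqP/anti; rewrite lexy -zy zx.
  by rewrite eqy ?eqx // (tr _ _ _ zx).
exists y; split=> [|z zy zy']; first by rewrite -eqx // eq_sym.
have zx : z != x.
  apply: contraNneq xy => zx.
  by apply/eqP/anti; rewrite leyx -zx zy.
by rewrite eqy ?eqx // (tr _ _ _ zy).
Qed.

Lemma tie_ltD m m1 m2 : tie_lt m1 m2 -> tie_lt (m1 + m) (m2 + m).
Proof.
move=> [x [ltx eqx]]; exists x; rewrite !mnmDE ltn_add2r; split=> // y yx yx'.
by rewrite !mnmDE eqx.
Qed.

Lemma chiD m m' :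
  chi k (sdeg pa (m + m')%MM) = chi k (sdeg pa m) * chi k (sdeg pa m').
Proof.
have -> : sdeg pa (m + m')%MM = monalg.mmul (sdeg pa m) (sdeg pa m').
  by apply: val_inj; rewrite /= degAD.
have /esym := @monalg.fgmulUU (semigroup pa) k 1 1 (sdeg pa m) (sdeg pa m').
by rewrite mulr1.
Qed.

Lemma chi0 : chi k (sdeg pa 0%MM) = 1.
Proof. by []. Qed.

Lemma chi_prod m :
  mmap1 (fun i => chi k (sdeg pa U_(i)%MM)) m = chi k (sdeg pa m).
Proof.
rewrite {2}[m]multinomUE_id (big_morph (fun m => chi k (sdeg pa m)) chiD chi0).
apply: eq_bigr => i _; elim: (m i) => [|e IH];
  first by rewrite mulm0n expr0 chi0.
by rewrite mulmS chiD -IH exprS.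
Qed.

Lemma mcoeff_toric_map (p : {mpoly k[r + s]}) (w : semigroup pa) :
  monalg.mcoeff w (toric_map pa p) =
  \sum_(m <- msupp p) p@_m * (sdeg pa m == w)%:R.
Proof.
rewrite /toric_map /mmap raddf_sum; apply: eq_bigr => m _ /=.
by rewrite chi_prod -scalerAl mul1r monalg.mcoeffZ monalg.mcoeffU.
Qed.

(** If [m] were alone in its fibre, the image of [p] would have the nonzero coefficient [p@_m] at
    the degree of [m]. *)
Lemma toric_ideal_fiber (p : {mpoly k[r + s]}) m : toric_ideal pa p ->
  m \in msupp p ->
  exists m', [/\ m' \in msupp p, m' != m & degA a m' = degA a m].
Proof.
move=> Ip pm; apply: contrapT => nm'.
have := mcoeff_toric_map p (sdeg pa m);
  rewrite [toric_map _ _]Ip monalg.mcoeff0.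
rewrite (bigD1_seq m) ?msupp_uniq //= eqxx mulr1 big_seq_cond big1 ?addr0.
  by move/esym/eqP; rewrite mcoeff_eq0 pm.
move=> m' /andP[pm' m'm]; case: eqP => [e|]; last by rewrite mulr0.
by case: nm'; exists m'; split=> //; move/(congr1 val): e.
Qed.

(** Some summand [c i * g i] must contain the monomial [M], and all monomials of that summand are
    multiples of [g i]. *)
Lemma ideal_span_monomial n (G : {mpoly k[n]} -> Prop) (M : 'X_{1..n}) :
    (forall g, G g -> exists m, g = 'X_[m]) -> ideal_span G 'X_[M] ->
  exists2 m, G 'X_[m] & (m <= M)%MM.
Proof.
move=> GX [N [c [g [Gg]]]] /(congr1 (mcoeff M)).
rewrite mcoeffX eqxx raddf_sum /= => E.
have /existsP[i nz] : [exists i, (c i * g i)@_M != 0].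
  apply: contraT; rewrite negb_exists => /forallP z; move: E.
  rewrite big1 => [/eqP|i _]; first by rewrite oner_eq0.
  by apply/eqP; move: (z i); rewrite negbK.
have [m gE] := GX _ (Gg i); exists m; first by rewrite -gE.
move: nz; rewrite -mcoeff_msupp gE (perm_mem (msuppMX _ _)) => /mapP[m' _ ->].
exact: lem_addr.
Qed.

Lemma mnm_join_lem v u : (mnm_join 0%MM u <= @mnm_join r s v u)%MM.
Proof. by apply/mnm_lepP => i; rewrite !mnmE; case: split => j;
  rewrite ?mnm0E. Qed.

Lemma mnm_joinE (m : mnm) : exists v u, m = mnm_join v u.
Proof.
exists [multinom m (lshift s i) | i < r], [multinom m (rshift r i) | i < s].
apply/mnmP => i; rewrite mnmE -{1}[i]splitK.
by case: split => j /=; rewrite mnmE.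
Qed.

Lemma ex_normal_form m : exists v u,
  [/\ degA a (mnm_join v u) = degA a m & Qset k pa le u].
Proof.
have [|m0 m0m m0min] := antichain_min (A := fun m' => degA a m' = degA a m)
  tie_lt_irr tie_lt_trans _ (erefl (degA a m)).
  by move=> m1 m2 e1 e2; apply: (degA_antichain pa); rewrite e1 e2.
have [v [u m0E]] := mnm_joinE m0; exists v, u; split; first by rewrite -m0E.
move=> /ideal_span_monomial[g [p [m1 [_ _ _ ->]]]|m1' [p [m1 [_ Ip [pm1 m1lead]
  +]]] +]; first by exists m1.
move=> /(congr1 (@msupp _ _)); rewrite !msuppX => -[->] m1u.
have m1m0 : (m1 <= m0)%MM by apply: lepm_trans m1u _; rewrite m0E mnm_join_lem.
(* Trading the factor [m1] of [m0] for [m2], a smaller monomial of the same degree, stays in the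
   fibre and goes below [m0], against minimality. *)
have [m2 [pm2 m21 deg2]] := toric_ideal_fiber Ip pm1.
have /(revlexE deg2)/(tie_ltD (m0 - m1)) := m1lead _ pm2 m21.
rewrite [(m1 + _)%MM]addmC submK //; apply: m0min.
by rewrite degAD deg2 -degAD addmC submK.
Qed.

End Toric.

(** * Both complexes read off from divisibility by variables *)

Section Faces.
Variables (k : fieldType) (d r s : nat) (a : 'I_(r + s) -> 'rV[int]_d).
Variables (pa : pointed a) (le : rel 'I_(r + s)) (w : semigroup pa).
Hypothesis le_order : variable_order le.

Definition incident (v : 'X_{1..r}) (i : 'I_r) : Prop :=
  Cset k le w v /\ (0 < v i)%N.

(** A monomial differs from 1 when some variable divides it, and a variable divides the gcd exactly
    when it divides every element of [F]. *)
Lemma Gamma_faceE (F : {fset 'X_{1..r}}) : F != fset0 ->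
  Gamma k le w F <-> exists i, forall v, v \in F -> incident v i.
Proof.
move=> F0; have gcdP i := mnm_gcdP U_(i)%MM F0.
split=> [[CF [FE|/eqP gF]]|[i iF]]; first by rewrite FE eqxx in F0.
  have [i gi] : exists i, mnm_gcd F i != 0%N.
    apply: contrapT => n; case/eqP: gF; apply/mnmP => i; rewrite mnm0E.
    by apply/eqP; apply: contrapT => gi; apply: n; exists i; apply/negP.
  exists i => v Fv; split; first exact: CF.
  by rewrite lt0n -lep1mP; apply: (gcdP i).1 Fv; rewrite lep1mP.
split=> [v /iF[] //|]; right => g0.
have /(gcdP i) : forall v, v \in F -> (U_(i) <= v)%MM.
  by move=> v /iF[_]; rewrite lt0n lep1mP.
by rewrite lep1mP g0 mnm0E.
Qed.

Lemma mnm_joinD v v' (u u' : 'X_{1..s}) :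
  mnm_join (v + v')%MM (u + u')%MM = (@mnm_join r s v u + mnm_join v' u')%MM.
Proof. by apply/mnmP => i; rewrite mnmDE !mnmE; case: split => j;
  rewrite !mnmDE. Qed.

(** The squarefree monomial with support [G]. *)
Definition fset_mnm (G : {fset 'I_r}) : 'X_{1..r} :=
  [multinom (i \in G : nat) | i < r].

Lemma degA_fset_mnm (G : {fset 'I_r}) :
  degA a (mnm_join (fset_mnm G) 0%MM) = \sum_(i <- G) a (lshift s i).
Proof.
rewrite (big_uniq _ (fset_uniq G)) /= [RHS]big_mkcond /degA big_split_ord /= [X
  in _ + X]big1.
  rewrite addr0; apply: eq_bigr => i _.
  by rewrite mnmE (unsplitK (inl _ i)) mnmE mulrb.
by move=> i _; rewrite mnmE (unsplitK (inr _ i)) mnm0E.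
Qed.

Lemma T_faceE (G : {fset 'I_r}) : G != fset0 ->
  T_complex w G <-> exists v, forall i, i \in G -> incident v i.
Proof.
move=> /fset0Pn[i0 Gi0]; split=> [[m mE]|[v vG]].
  (* Membership in [Cset] restricts only the exponent [u], so the normal form of the remainder may
     be multiplied by the variables of [G]. *)
  have [v [u [e Qu]]] := ex_normal_form k pa le_order m.
  exists (v + fset_mnm G)%MM => i Gi; split;
    last by rewrite mnmDE mnmE Gi addn1.
  exists u => //; rewrite -[u]addm0 mnm_joinD degAD e degA_fset_mnm -mE.
  by rewrite subrK.
(* A vertex of the nonempty [G] supplies [u]; since all variables of [G] divide [v], so does their
   product, and it can be divided out. *)
have [[u _ degw] _] := vG _ Gi0.
have vE : v = ((v - fset_mnm G) + fset_mnm G)%MM.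
  rewrite submK //; apply/mnm_lepP => i; rewrite mnmE.
  by case: (boolP (i \in G)) => // /vG[].
exists (mnm_join (v - fset_mnm G) u).
by rewrite -degw {1}vE -{1}[u]addm0 mnm_joinD degAD degA_fset_mnm addrK.
Qed.

End Faces.

Theorem theorem16 (k : fieldType) (d r s : nat)
  (a : 'I_(r + s) -> 'rV[int]_d) (inj_a : injective a) (pa : pointed a)
  (pos_a : forall x : 'rV[rat]_d,
     pos a x <-> pos (fun i : 'I_r => a (lshift s i)) x)
  (le : rel 'I_(r + s)) (le_order : variable_order le)
  (t : nat) (F : graded_free_resolution k pa t)
  (w : semigroup pa) (i : nat) (le_i_t : (i <= t)%N) :
  exists f : {linear reduced_homology k (Gamma k le w) i ->
                     reduced_homology k (T_complex w) i},
    bijective f.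
Proof.
apply: (@dowker_homology_iso _ _ _ _ _ _ _ (@incident k d r s a pa le w)).
  exact: Gamma_faceE.
exact: T_faceE.
Qed.
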